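(* Let $ABC$ be a nondegenerate triangle and let $l$ be a fixed line through $A$. Then there is a line $l'$, parallel to (or coinciding with) the isogonal of $l$ with respect to angle $A$, such that for every admissible pair of cevians $BB_A, CC_A$ whose Miquel–Steiner point $M_A\neq A$ belongs to $l$, the intersection point $N_A$ of the cevians $BB_A$ and $CC_A$ belongs to $l'$.
   Context: Work in the Euclidean plane with a nondegenerate triangle $ABC$. An admissible pair of cevians consists of lines $BB_A$ and $CC_A$, where $B_A$ is a point of line $AC$ with $B_A\neq A, C$, and $C_A$ is a point of line $AB$ with $C_A\neq A, B$ (the points may lie outside the sides), such that $BB_A$ and $CC_A$ are not parallel. Let $N_A$ be the intersection point of $BB_A$ and $CC_A$. The circumcircles of the four triangles $ABB_A$, $ACC_A$, $CB_AN_A$, $BC_AN_A$ have a unique common point $M_A$, called the Miquel–Steiner point of triangle $ABC$ with cevians $BB_A, CC_A$ (equivalently, $M_A$ is the common point other than $A$ of the circumcircles of $ABB_A$ and $ACC_A$). The isogonal of a line $l$ through $A$ (with respect to angle $A$) is the reflection of $l$ in the internal bisector of angle $BAC$. *)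

(* Defs.v *)
From Stdlib Require Import Reals.
From Coquelicot Require Import Coquelicot.

Open Scope C_scope.

(** The Euclidean plane is the complex plane of Coquelicot, with Euclidean norm
    [Cmod].  Lines and circles are sets of points. *)
Notation point := Complex.C.

Definition line (P u : point) : point -> Prop :=
  fun Z => exists t : R, Z = P + RtoC t * u.

Definition is_line (l : point -> Prop) : Prop :=
  exists P u : point, u <> 0 /\ forall Z : point, l Z <-> line P u Z.

(** A line only when [P <> Q]. *)
Definition line_through (P Q : point) : point -> Prop := line P (Q - P).

(** Strict parallelism: a line is not parallel to itself. *)
Definition parallel (l m : point -> Prop) : Prop :=
  ~ exists Z : point, l Z /\ m Z.

Definition coincide (l m : point -> Prop) : Prop :=
  forall Z : point, l Z <-> m Z.

Definition collinear (P Q S : point) : Prop :=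
  exists l : point -> Prop, is_line l /\ l P /\ l Q /\ l S.

Definition circle (O : point) (r : R) : point -> Prop :=
  fun Z => Cmod (Z - O) = r.

(** When [P], [Q], [S] are not collinear, exactly one pair [(O, r)] qualifies. *)
Definition circumcircle (P Q S : point) : point -> Prop :=
  fun Z => exists (O : point) (r : R),
    circle O r P /\ circle O r Q /\ circle O r S /\ circle O r Z.

(** Orthogonal reflection in [line P u], for [u <> 0]: in the coordinate
    [(Z - P) / u] this line is the real axis. *)
Definition reflection (P u Z : point) : point :=
  P + u * Cconj ((Z - P) / u).

(** The sum of the unit vectors along the rays [AB] and [AC]; it directs the
    internal bisector of the angle [BAC]. *)
Definition bisector_dir (A B C : point) : point :=
  (B - A) / RtoC (Cmod (B - A)) + (C - A) / RtoC (Cmod (C - A)).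

Definition isogonal (A B C : point) (l : point -> Prop) : point -> Prop :=
  fun Z => exists W : point, l W /\ Z = reflection A (bisector_dir A B C) W.

Definition admissible (A B C B_A C_A : point) : Prop :=
  line_through A C B_A /\ B_A <> A /\ B_A <> C /\
  line_through A B C_A /\ C_A <> A /\ C_A <> B /\
  ~ parallel (line_through B B_A) (line_through C C_A).

Definition cevian_intersection (B C B_A C_A N : point) : Prop :=
  line_through B B_A N /\ line_through C C_A N.

(** For an admissible pair of cevians meeting at [N], exactly one [M] qualifies. *)
Definition miquel_steiner (A B C B_A C_A N M : point) : Prop :=
  circumcircle A B B_A M /\ circumcircle A C C_A M /\
  circumcircle C B_A N M /\ circumcircle B C_A N M.

(* Main.v *)
Require Import Defs.
From Stdlib Require Import Reals Lra Classical.
From Coquelicot Require Import Coquelicot.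

Local Open Scope C_scope.

(** Put [A] at the origin, [b = B - A], [c = C - A], [B_A = A + s c],
    [C_A = A + t b].  The power of a point with respect to a circle through the
    origin is [|Z|^2] minus a linear form in [Z], so the Miquel-Steiner point
    [x b + y c] satisfies [x |b|^2 + y s |c|^2 = x t |b|^2 + y |c|^2], that is
    [X (1 - t) = Y (1 - s)] with [X = x |b|^2] and [Y = y |c|^2].  Thus the
    direction of [l] determines the ratio [(1 - s) : (1 - t)].  The isogonal of
    [x b + y c] is directed by [Y b + X c], and the intersection
    [beta b + gamma c] of the cevians, for which [s beta + gamma = s] and
    [beta + t gamma = t], satisfies
    [(beta - 1) (1 - s) = (gamma - 1) (1 - t)].  Hence it lies on the parallel
    to the isogonal through the fourth vertex [B + C - A] of the
    parallelogram. *)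

(** * Lines and real coordinates in a basis of the plane *)

Definition cross (u v : point) : R := (fst u * snd v - snd u * fst v)%R.

Definition dot (u v : point) : R := (fst u * fst v + snd u * snd v)%R.

Ltac real_coords := apply injective_projections; simpl.

Lemma line_base_change (P u Q Z : point) :
  line P u Q -> line P u Z <-> line Q u Z.
Proof.
  intros [q ->]; split; intros [t ->].
  - exists (t - q)%R. rewrite RtoC_minus. ring.
  - exists (q + t)%R. rewrite RtoC_plus. ring.
Qed.

Lemma line_scale_dir (P u : point) (k : R) (Z : point) :
  k <> 0%R -> line P (RtoC k * u) Z <-> line P u Z.
Proof.
  intros Hk; split; intros [t ->].
  - exists (t * k)%R. rewrite RtoC_mult. ring.
  - exists (t / k)%R. rewrite RtoC_div by exact Hk. field.
    intros H; apply Hk, RtoC_inj, H.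
Qed.

(** A common point can serve as base point of both lines. *)
Lemma line_parallel_or_coincide (P Q u : point) :
  parallel (line P u) (line Q u) \/ coincide (line P u) (line Q u).
Proof.
  destruct (classic (exists Z, line P u Z /\ line Q u Z)) as [[Z [HP HQ]]|H].
  - right; intros W.
    rewrite (line_base_change _ _ _ _ HP), (line_base_change _ _ _ _ HQ).
    reflexivity.
  - left; exact H.
Qed.

Lemma dot_diag_eq0 (z : point) : dot z z = 0%R -> z = 0.
Proof.
  intros E; unfold dot in E.
  destruct (Rplus_sqr_eq_0 (fst z) (snd z) E) as [E1 E2].
  real_coords; assumption.
Qed.

Lemma cross_neq0_of_not_collinear (P Q S : point) :
  ~ collinear P Q S -> cross (Q - P) (S - P) <> 0%R.
Proof.
  intros H H0; apply H; clear H.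
  destruct (classic (Q = P)) as [->|HQP].
  - destruct (classic (S = P)) as [->|HSP].
    + exists (line P 1); split; [exists P, 1; split; [exact C1_nz|reflexivity]|].
      repeat split; exists 0%R; ring.
    + exists (line P (S - P)); split.
      { exists P, (S - P); split; [|reflexivity].
        intros E; apply HSP; rewrite <- (Cplus_0_l P), <- E; ring. }
      repeat split; [exists 0%R|exists 0%R|exists 1%R]; ring.
  - exists (line P (Q - P)); split.
    { exists P, (Q - P); split; [|reflexivity].
      intros E; apply HQP; rewrite <- (Cplus_0_l P), <- E; ring. }
    repeat split; [exists 0%R; ring|exists 1%R; ring|].
    (* Parameter of the orthogonal projection of [S] onto the line [PQ]. Both coordinates of the
       residue carry the factor [cross (Q - P) (S - P)], hence vanish. *)
    exists (dot (Q - P) (S - P) / dot (Q - P) (Q - P))%R.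
    assert (Hd : dot (Q - P) (Q - P) <> 0%R).
    { intros E; apply dot_diag_eq0 in E; apply HQP.
      rewrite <- (Cplus_0_l P), <- E; ring. }
    revert H0 Hd; unfold cross, dot; destruct P as [p1 p2], Q as [q1 q2], S as [s1 s2].
    simpl; intros H0 Hd.
    real_coords; apply Rminus_diag_uniq.
    + transitivity (- (q2 + - p2)
        * ((q1 + - p1) * (s2 + - p2) - (q2 + - p2) * (s1 + - p1))
        / ((q1 + - p1) * (q1 + - p1) + (q2 + - p2) * (q2 + - p2)))%R.
      * field; exact Hd.
      * rewrite H0; field; exact Hd.
    + transitivity ((q1 + - p1)
        * ((q1 + - p1) * (s2 + - p2) - (q2 + - p2) * (s1 + - p1))
        / ((q1 + - p1) * (q1 + - p1) + (q2 + - p2) * (q2 + - p2)))%R.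
      * field; exact Hd.
      * rewrite H0; field; exact Hd.
Qed.

(** Cramer's rule. *)
Lemma cross_neq0_decompose (b c u : point) :
  cross b c <> 0%R -> exists x y : R, u = RtoC x * b + RtoC y * c.
Proof.
  intros H; exists (cross u c / cross b c)%R, (cross b u / cross b c)%R.
  revert H; unfold cross; destruct b, c, u; simpl; intros H.
  real_coords; field; exact H.
Qed.

Lemma cross_neq0_coords_inj (b c : point) (x y x' y' : R) :
  cross b c <> 0%R ->
  RtoC x * b + RtoC y * c = RtoC x' * b + RtoC y' * c -> x = x' /\ y = y'.
Proof.
  unfold cross; destruct b as [b1 b2], c as [c1 c2]; simpl; intros H E.
  injection E as E1 E2.
  assert (F1 := f_equal (Rmult c2) E1); assert (F2 := f_equal (Rmult c1) E2).
  assert (G1 := f_equal (Rmult b2) E1); assert (G2 := f_equal (Rmult b1) E2).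
  split; apply (Rmult_eq_reg_r (b1 * c2 - b2 * c1)%R); trivial; lra.
Qed.

(** * Circles through [A] and the Miquel-Steiner point *)

Lemma Cmod_eq_dot (z w : point) : Cmod z = Cmod w -> dot z z = dot w w.
Proof.
  intros E; assert (E2 : (Cmod z ^ 2 = Cmod w ^ 2)%R) by now rewrite E.
  unfold Cmod in E2; rewrite !pow2_sqrt in E2 by nra; unfold dot; lra.
Qed.

(** Expanding [|Z - O|^2 = |A - O|^2] around [A] cancels the term [|O - A|^2]. What remains is
    linear in [Z - A] on the right, with [w] twice the vector from [A] to the centre. *)
Lemma circumcircle_linear_form (A P Q M : point) :
  circumcircle A P Q M ->
  exists w : point, dot (P - A) (P - A) = dot w (P - A) /\
    dot (Q - A) (Q - A) = dot w (Q - A) /\ dot (M - A) (M - A) = dot w (M - A).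
Proof.
  intros (O & r & HA & HP & HQ & HM); unfold circle in *.
  exists (RtoC 2 * (O - A)).
  assert (K : forall Z, Cmod (Z - O) = r ->
                dot (Z - A) (Z - A) = dot (RtoC 2 * (O - A)) (Z - A)).
  { intros Z HZ; assert (E : Cmod (Z - O) = Cmod (A - O)) by congruence.
    apply Cmod_eq_dot in E; revert E; unfold dot; destruct A, Z, O; simpl.
    intros E; nra. }
  auto.
Qed.

Lemma miquel_ratio (A b c : point) (s t x y k : R) :
  s <> 0%R -> t <> 0%R -> k <> 0%R ->
  circumcircle A (A + b) (A + RtoC s * c) (A + RtoC k * (RtoC x * b + RtoC y * c)) ->
  circumcircle A (A + c) (A + RtoC t * b) (A + RtoC k * (RtoC x * b + RtoC y * c)) ->
  (x * dot b b * (1 - t) = y * dot c c * (1 - s))%R.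
Proof.
  intros Hs Ht Hk H1 H2.
  apply circumcircle_linear_form in H1 as (p & P1 & P2 & P3).
  apply circumcircle_linear_form in H2 as (q & Q1 & Q2 & Q3).
  assert (R0 : forall z : point, A + z - A = z) by (intros z; ring).
  rewrite !R0 in *.
  assert (S1 : forall (a : R) (z w : point), dot w (RtoC a * z) = (a * dot w z)%R)
    by (intros a [] []; unfold dot; simpl; ring).
  assert (S2 : forall (a : R) (z w : point), dot (RtoC a * w) z = (a * dot w z)%R)
    by (intros a [] []; unfold dot; simpl; ring).
  assert (S3 : forall z z' w : point, dot w (z + z') = (dot w z + dot w z')%R)
    by (intros [] [] []; unfold dot; simpl; ring).
  rewrite !S1, !S2 in P2, P3, Q2, Q3.
  (* Each equation has a nonzero factor [s], [t] or [k] to cancel. *)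
  apply Rmult_eq_reg_l in P2, P3, Q2, Q3; trivial.
  (* The forms [p] and [q] agree at [x b + y c], both giving [k |x b + y c|^2] there. Their values
     at [b] and [c] are known from the other points of the circles. *)
  rewrite P3, !S3, !S1 in Q3.
  rewrite <- P1, <- P2, <- Q1, <- Q2 in Q3.
  lra.
Qed.

(** * The isogonal line *)

Lemma Cmult_conj_unit (z : point) :
  z <> 0 -> z / RtoC (Cmod z) * Cconj (z / RtoC (Cmod z)) = 1.
Proof.
  intros Hz.
  assert (Hm : RtoC (Cmod z) <> 0).
  { intros E; apply RtoC_inj in E; apply Hz, Cmod_eq_0, E. }
  rewrite <- Cmod2_conj, Cmod_div by exact Hm.
  rewrite Cmod_R, Rabs_pos_eq by apply Cmod_ge_0.
  replace (Cmod z / Cmod z)%R with 1%R; [now rewrite pow1|].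
  field; intros E; apply Hm; now rewrite E.
Qed.

(** For unit [e] and [f], conjugation is inversion, so [e + f = Cconj (e + f) * e * f]. Hence
    [(e + f) / Cconj (e + f)] is [e * f]. *)
Lemma bisector_reflection (b c w : point) :
  b <> 0 -> c <> 0 -> b / RtoC (Cmod b) + c / RtoC (Cmod c) <> 0 ->
  (b / RtoC (Cmod b) + c / RtoC (Cmod c)) *
    Cconj (w / (b / RtoC (Cmod b) + c / RtoC (Cmod c)))
  = Cconj w * (b / RtoC (Cmod b)) * (c / RtoC (Cmod c)).
Proof.
  intros Hb Hc.
  pose proof (Cmult_conj_unit b Hb) as He; pose proof (Cmult_conj_unit c Hc) as Hf.
  set (e := b / RtoC (Cmod b)) in *; set (f := c / RtoC (Cmod c)) in *.
  intros Hd.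
  assert (Hcd : Cconj (e + f) <> 0).
  { intros E; apply Hd; rewrite <- (Cconj_conj (e + f)), E.
    real_coords; ring. }
  rewrite Cdiv_conj by exact Hd.
  assert (E : e + f = Cconj (e + f) * e * f).
  { rewrite Cplus_conj.
    transitivity (e * Cconj e * f + f * Cconj f * e); [rewrite He, Hf|]; ring. }
  rewrite E at 1; field; exact Hcd.
Qed.

(** The reflection sends [x b + y c] to its conjugate times [b c / (|b| |c|)]. Since
    [b * Cconj b = |b|^2], and likewise for [c], this is [y |c|^2 b + x |b|^2 c] divided by
    [|b| |c|]. *)
Lemma isogonal_line (A B C : point) (l : point -> Prop) (x y : R) :
  cross (B - A) (C - A) <> 0%R ->
  (forall Z, l Z <-> line A (RtoC x * (B - A) + RtoC y * (C - A)) Z) ->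
  forall Z, isogonal A B C l Z <->
    line A (RtoC (y * dot (C - A) (C - A)) * (B - A)
            + RtoC (x * dot (B - A) (B - A)) * (C - A)) Z.
Proof.
  unfold isogonal, reflection, bisector_dir.
  set (b := B - A); set (c := C - A); intros H Hl Z.
  assert (Hb : b <> 0)
    by (intros E; apply H; rewrite E; unfold cross; simpl; ring).
  assert (Hc : c <> 0)
    by (intros E; apply H; rewrite E; unfold cross; simpl; ring).
  assert (Hmb : Cmod b <> 0%R) by (intros E; apply Hb, Cmod_eq_0, E).
  assert (Hmc : Cmod c <> 0%R) by (intros E; apply Hc, Cmod_eq_0, E).
  assert (HB : RtoC (Cmod b) <> 0) by (intros E; apply Hmb, RtoC_inj, E).
  assert (HC : RtoC (Cmod c) <> 0) by (intros E; apply Hmc, RtoC_inj, E).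
  (* If the bisector direction vanished, clearing denominators would give the nontrivial relation
     [|c| b + |b| c = 0]. *)
  assert (Hd : b / RtoC (Cmod b) + c / RtoC (Cmod c) <> 0).
  { intros E.
    assert (E' : RtoC (Cmod c) * b + RtoC (Cmod b) * c = RtoC 0 * b + RtoC 0 * c).
    { transitivity (RtoC (Cmod b) * RtoC (Cmod c)
                    * (b / RtoC (Cmod b) + c / RtoC (Cmod c))).
      - field; auto.
      - rewrite E; ring. }
    apply (cross_neq0_coords_inj _ _ _ _ _ _ H) in E' as [E' _]; auto. }
  set (k := (/ (Cmod b * Cmod c))%R).
  assert (Hk : k <> 0%R)
    by (apply Rinv_neq_0_compat, Rmult_integral_contrapositive; auto).
  rewrite <- (line_scale_dir A _ k Z Hk).
  set (v := RtoC k * _).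
  assert (Hv : forall t : R,
    A + (b / RtoC (Cmod b) + c / RtoC (Cmod c)) *
      Cconj ((A + RtoC t * (RtoC x * b + RtoC y * c) - A)
             / (b / RtoC (Cmod b) + c / RtoC (Cmod c))) = A + RtoC t * v).
  { intros t.
    rewrite bisector_reflection by assumption.
    assert (Hdot : forall z : point, RtoC (dot z z) = z * Cconj z)
      by (intros []; unfold dot; real_coords; ring).
    assert (Hconj : forall a : R, Cconj (RtoC a) = RtoC a)
      by (intros a; real_coords; ring).
    unfold v, k.
    rewrite RtoC_inv by (apply Rmult_integral_contrapositive; auto).
    rewrite !RtoC_mult, !Hdot.
    replace (A + RtoC t * (RtoC x * b + RtoC y * c) - A)
      with (RtoC t * (RtoC x * b + RtoC y * c)) by ring.
    rewrite Cmult_conj, Cplus_conj, !Cmult_conj, !Hconj.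
    field; auto. }
  split.
  - intros (W & HW & ->); apply Hl in HW as [t ->]; exists t; apply Hv.
  - intros [t ->]; exists (A + RtoC t * (RtoC x * b + RtoC y * c)); split.
    + apply Hl; exists t; reflexivity.
    + symmetry; apply Hv.
Qed.

(** * The intersection of the cevians *)

Lemma cevian_intersection_line (A B C N : point) (s t X Y : R) :
  cross (B - A) (C - A) <> 0%R -> s <> 1%R -> t <> 1%R ->
  (X * (1 - t) = Y * (1 - s))%R -> (X <> 0 \/ Y <> 0)%R ->
  cevian_intersection B C (A + RtoC s * (C - A)) (A + RtoC t * (B - A)) N ->
  line (B + C - A) (RtoC Y * (B - A) + RtoC X * (C - A)) N.
Proof.
  intros H Hs Ht HXY H0 [[r Hr] [r' Hr']].
  (* [N - A] read on each of the two cevians. *)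
  assert (E : RtoC (1 - r) * (B - A) + RtoC (r * s) * (C - A)
              = RtoC (r' * t) * (B - A) + RtoC (1 - r') * (C - A)).
  { rewrite !RtoC_minus, !RtoC_mult.
    transitivity (N - A); [rewrite Hr|rewrite Hr']; ring. }
  apply (cross_neq0_coords_inj _ _ _ _ _ _ H) in E as [E1 E2].
  (* [X] and [Y] are [1 - s] and [1 - t] times a common factor [m], nonzero because [X] and [Y] are
     not both zero. *)
  assert (HX : X = (X / (1 - s) * (1 - s))%R) by (field; lra).
  assert (HY : Y = (X / (1 - s) * (1 - t))%R).
  { apply (Rmult_eq_reg_r (1 - s)%R); [|lra].
    rewrite <- HXY; field; lra. }
  set (m := (X / (1 - s))%R) in *.
  assert (Hm : m <> 0%R) by (intros E; rewrite E in HX, HY; lra).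
  (* From the fourth vertex, [N] has coordinates [- r] and [r s - 1]; the parameter is [- r / Y]. *)
  exists (- r / (m * (1 - t)))%R.
  assert (F1 : (- r / (m * (1 - t)) * Y = - r)%R) by (rewrite HY; field; lra).
  assert (F2 : (- r / (m * (1 - t)) * X = r * s - 1)%R).
  { rewrite HX; apply (Rmult_eq_reg_r (1 - t)%R); [|lra].
    transitivity (- r * (1 - s))%R; [field; lra|].
    (* By [E1] and [E2], [r (1 - s) = r' (1 - t)]. *)
    replace (r * s - 1)%R with (- r')%R by lra.
    nra. }
  rewrite Cmult_plus_distr_l, !Cmult_assoc, <- !RtoC_mult, F1, F2, Hr.
  rewrite RtoC_minus, RtoC_mult, RtoC_opp; ring.
Qed.

Theorem mainTheorem4 (A B C : point) (hABC : ~ collinear A B C)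
    (l : point -> Prop) (hl : is_line l) (hlA : l A) :
  exists l' : point -> Prop,
    is_line l' /\
    (parallel l' (isogonal A B C l) \/ coincide l' (isogonal A B C l)) /\
    forall B_A C_A N_A M_A : point,
      admissible A B C B_A C_A ->
      cevian_intersection B C B_A C_A N_A ->
      miquel_steiner A B C B_A C_A N_A M_A ->
      M_A <> A ->
      l M_A ->
      l' N_A.
Proof.
  pose proof (cross_neq0_of_not_collinear _ _ _ hABC) as H.
  destruct hl as (P & u & Hu & Hl).
  destruct (cross_neq0_decompose _ _ u H) as (x & y & Eu).
  assert (HlA : forall Z, l Z <-> line A (RtoC x * (B - A) + RtoC y * (C - A)) Z).
  { intros Z; rewrite Hl, (line_base_change P u A Z), Eu; [reflexivity|].
    apply Hl, hlA. }
  pose proof (isogonal_line A B C l x y H HlA) as Hiso.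
  assert (Hbb : dot (B - A) (B - A) <> 0%R).
  { intros E; apply H; rewrite (dot_diag_eq0 _ E); unfold cross; simpl; ring. }
  assert (Hcc : dot (C - A) (C - A) <> 0%R).
  { intros E; apply H; rewrite (dot_diag_eq0 _ E); unfold cross; simpl; ring. }
  set (X := (x * dot (B - A) (B - A))%R) in *.
  set (Y := (y * dot (C - A) (C - A))%R) in *.
  assert (HXY : (X <> 0 \/ Y <> 0)%R).
  { destruct (Req_dec x 0) as [Hx|Hx].
    - right; apply Rmult_integral_contrapositive; split; trivial.
      intros Hy; apply Hu; rewrite Eu, Hx, Hy; ring.
    - left; apply Rmult_integral_contrapositive; auto. }
  exists (line (B + C - A) (RtoC Y * (B - A) + RtoC X * (C - A))).
  split; [|split].
  - exists (B + C - A), (RtoC Y * (B - A) + RtoC X * (C - A)).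
    split; [|reflexivity]; intros E.
    destruct (cross_neq0_coords_inj (B - A) (C - A) Y X 0 0 H) as [E1 E2].
    + rewrite E; ring.
    + destruct HXY; auto.
  (* By [Hiso] the isogonal is the line through [A] with the direction of [l']. *)
  - destruct (line_parallel_or_coincide (B + C - A) A
                (RtoC Y * (B - A) + RtoC X * (C - A))) as [K|K].
    + left; intros (Z & HZ & HZ'); apply K; exists Z; split; trivial.
      apply Hiso, HZ'.
    + right; intros Z; rewrite Hiso; apply K.
  - intros B_A C_A N M ([s ->] & HB1 & HB2 & [t ->] & HC1 & HC2 & _) HN
      (HM1 & HM2 & _) HMA HM.
    apply HlA in HM as [k ->].
    (* The points [B_A] and [C_A] avoid the vertices, so [s] and [t] differ from 0 and 1; [M_A <> A]
       gives [k <> 0]. *)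
    apply (cevian_intersection_line A B C N s t); trivial.
    + intros E; apply HB2; rewrite E; ring.
    + intros E; apply HC2; rewrite E; ring.
    + apply (miquel_ratio A (B - A) (C - A) s t x y k).
      * intros E; apply HB1; rewrite E; ring.
      * intros E; apply HC1; rewrite E; ring.
      * intros E; apply HMA; rewrite E; ring.
      * replace (A + (B - A)) with B by ring; exact HM1.
      * replace (A + (C - A)) with C by ring; exact HM2.
Qed.
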